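(* Given a literal $l$, a finite prerequisite-free normal unary default theory $\langle D,W\rangle$ where $W$ is a set of literals, and a strict partial order $\mathcal{P}$ on $D$, each of the problems of testing $\langle D,W\rangle\models^{BH}_{\mathcal{P}}l$ and testing $\langle D,W\rangle\models^{B}_{\mathcal{P}}l$ can be solved in polynomial time.
   Context: $\mathcal{L}$ is the set of formulae of classical propositional logic, $\models$ classical logical consequence, and $Cn(S)=\{\phi\in\mathcal{L}\mid S\models\phi\}$ for $S\subseteq\mathcal{L}$. A default here is a rule $\alpha{:}\beta/\gamma$ with $\alpha,\beta,\gamma\in\mathcal{L}$ (prerequisite, justification, conclusion); it is normal if $\beta=\gamma$, and prerequisite-free, written $:\beta/\gamma$, if $\alpha$ is the valid formula $\top$. A default theory is a pair $\langle D,W\rangle$ with $D$ a set of defaults and $W\subseteq\mathcal{L}$. It is prerequisite-free normal unary if every default in $D$ has the form $:q/q$ or $:\neg q/\neg q$ with $q$ a propositional variable. A strict partial order is a transitive asymmetric relation; $\delta\mathcal{P}\delta'$ means that $\delta$ has higher priority than $\delta'$. A default $\alpha{:}\beta/\gamma$ is active in $E\subseteq\mathcal{L}$ if $E\models\alpha$, $E\not\models\neg\beta$ and $E\not\models\gamma$. Preferred$^{BH}$: for $E\subseteq\mathcal{L}$ define $E_0=W$ and for all $i\ge 0$, $$E_{i+1}=E_i\cup\{\gamma\mid \alpha{:}\beta/\gamma\in D,\ E_i\models\alpha,\ E\not\models\neg\beta,\ \text{no }\delta\in D\text{ with }\delta\,\mathcal{P}\,(\alpha{:}\beta/\gamma)\text{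 is active in }E_i\};$$ $E$ is a $\mathcal{P}$-preferred$^{BH}$ extension of $\langle D,W\rangle$ iff $E=\bigcup_{i\ge 0}Cn(E_i)$. Preferred$^{B}$ (for normal default theories): $E\subseteq\mathcal{L}$ is a $\mathcal{P}$-preferred$^B$ extension of $\langle D,W\rangle$ if there is a strict total order $\mathcal{T}$ on $D$ with $\mathcal{P}\subseteq\mathcal{T}$ such that $E=\bigcup_{i\ge 0}Cn(E_i)$, where $E_0=W$ and for all $i\ge 0$, $$E_{i+1}=E_i\cup\{\beta\mid \alpha{:}\beta/\beta\in D,\ E_i\models\alpha,\ E_i\not\models\neg\beta,\ \text{no }\delta\in D\text{ with }\delta\,\mathcal{T}\,(\alpha{:}\beta/\beta)\text{ is active in }E_i\}.$$ $\Delta\models^{BH}_{\mathcal{P}}\phi$ (respectively $\Delta\models^{B}_{\mathcal{P}}\phi$) means that $\phi$ belongs to all $\mathcal{P}$-preferred$^{BH}$ (respectively $\mathcal{P}$-preferred$^{B}$) extensions of $\Delta$. *)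

(* Defs.v *)
From HB Require Import structures.
From mathcomp Require Import all_boot all_order all_algebra.
From mathcomp Require Import all_classical.

Set Implicit Arguments.
Unset Strict Implicit.
Unset Printing Implicit Defensive.

Local Open Scope classical_set_scope.

Inductive formula : Type :=
| Var of nat
| Top
| Bot
| Neg of formula
| And of formula & formula
| Or of formula & formula
| Imp of formula & formula.

Lemma formula_eq_dec : comparable formula.
Proof. by move=> x y; rewrite /decidable; decide equality; exact: eq_comparable. Qed.

HB.instance Definition _ := hasDecEq.Build formula (compareP formula_eq_dec).

Fixpoint eval (v : nat -> bool) (f : formula) : bool :=
  match f with
  | Var q => v q
  | Top => true
  | Bot => false
  | Neg g => ~~ eval v g
  | And g h => eval v g && eval v h
  | Or g h => eval v g || eval v h
  | Imp g h => eval v g ==> eval v h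
  end.

Definition entails (S : set formula) (f : formula) : Prop :=
  forall v : nat -> bool, (forall g, S g -> eval v g) -> eval v f.

Definition Cn (S : set formula) : set formula := [set f | entails S f].

Definition is_literal (f : formula) : Prop :=
  exists q : nat, f = Var q \/ f = Neg (Var q).

Record default : Type := Default {
  prerequisite : formula;
  justification : formula;
  conclusion : formula }.

Lemma default_eq_dec : comparable default.
Proof. by move=> x y; rewrite /decidable; decide equality; exact: eq_comparable. Qed.

HB.instance Definition _ := hasDecEq.Build default (compareP default_eq_dec).

Definition prereq_free_normal_unary (D : set default) : Prop :=
  forall d, D d -> exists q : nat,
    d = Default Top (Var q) (Var q) \/
    d = Default Top (Neg (Var q)) (Neg (Var q)).

(** A priority relation [P d d'] reads: [d] has higher priority than [d']. *)
Definition priority := default -> default -> Prop.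

Definition strict_partial_order (D : set default) (P : priority) : Prop :=
  [/\ (forall d d', P d d' -> D d /\ D d'),
      (forall d1 d2 d3, P d1 d2 -> P d2 d3 -> P d1 d3) &
      (forall d d', P d d' -> ~ P d' d)].

Definition strict_total_order (D : set default) (T : priority) : Prop :=
  strict_partial_order D T /\
  (forall d d', D d -> D d' -> d <> d' -> T d d' \/ T d' d).

Definition active (E : set formula) (d : default) : Prop :=
  [/\ entails E (prerequisite d),
      ~ entails E (Neg (justification d)) &
      ~ entails E (conclusion d)].

Section Extensions.
Variables (D : set default) (W : set formula).

Fixpoint stage_BH (P : priority) (E : set formula) (i : nat) : set formula :=
  match i with
  | 0 => W
  | j.+1 =>
      let Ej := stage_BH P E j in
      Ej `|` [set c | exists a b,
        [/\ D (Default a b c), entails Ej a, ~ entails E (Neg b) &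
            ~ exists d, [/\ D d, P d (Default a b c) & active Ej d]]]
  end.

Definition preferred_BH (P : priority) (E : set formula) : Prop :=
  E = \bigcup_i Cn (stage_BH P E i).

Fixpoint stage_B (T : priority) (i : nat) : set formula :=
  match i with
  | 0 => W
  | j.+1 =>
      let Ej := stage_B T j in
      Ej `|` [set b | exists a,
        [/\ D (Default a b b), entails Ej a, ~ entails Ej (Neg b) &
            ~ exists d, [/\ D d, T d (Default a b b) & active Ej d]]]
  end.

Definition preferred_B (P : priority) (E : set formula) : Prop :=
  exists T : priority,
    [/\ strict_total_order D T,
        (forall d d', P d d' -> T d d') &
        E = \bigcup_i Cn (stage_B T i)].

Definition entails_BH (P : priority) (f : formula) : Prop :=
  forall E, preferred_BH P E -> E f.

Definition entails_B (P : priority) (f : formula) : Prop :=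
  forall E, preferred_B P E -> E f.

End Extensions.

Inductive move := MoveLeft | Stay | MoveRight.

(** A cell is blank ([None]) or holds an input symbol ([inl]) or an auxiliary
    symbol of the machine ([inr]).  There are [tm_aux.+1] two-way infinite
    tapes; tape [ord0] carries the input.  [tm_halt q = Some b] means that [q]
    is a halting state with answer [b]. *)
Record machine (S : finType) := Machine {
  tm_aux : nat;
  tm_sym : finType;
  tm_state : finType;
  tm_start : tm_state;
  tm_halt : tm_state -> option bool;
  tm_trans : tm_state * {ffun 'I_tm_aux.+1 -> option (S + tm_sym)} ->
             tm_state * {ffun 'I_tm_aux.+1 -> option (S + tm_sym)} *
               ('I_tm_aux.+1 -> move) }.

Definition cell S (M : machine S) : Type := option (S + tm_sym M).

(** The cells left of the head (nearest first), the scanned cell and the cells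
    right of the head (nearest first); all cells beyond the lists are blank. *)
Record tape (C : Type) := Tape { tleft : seq C; thead : C; tright : seq C }.

Definition write_move C (t : tape (option C)) (c : option C) (m : move) :=
  match m with
  | MoveLeft =>
      Tape (behead (tleft t)) (head None (tleft t)) (c :: tright t)
  | Stay => Tape (tleft t) c (tright t)
  | MoveRight =>
      Tape (c :: tleft t) (head None (tright t)) (behead (tright t))
  end.

Record config S (M : machine S) := Config {
  cstate : tm_state M;
  ctape : 'I_(tm_aux M).+1 -> tape (cell M) }.

Definition init S (M : machine S) (w : seq S) : config M :=
  let cells : seq (cell M) := [seq Some (inl s) | s <- w] in
  Config (tm_start M) (fun i =>
    if i == ord0 then Tape [::] (head None cells) (behead cells)
    else Tape [::] None [::]).

Definition step S (M : machine S) (c : config M) : config M :=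
  let: (q, w, m) := tm_trans (cstate c, [ffun i => thead (ctape c i)]) in
  Config q (fun i => write_move (ctape c i) (w i) (m i)).

(** [M], started on [w], enters its first halting state after exactly [n]
    steps, with answer [b]. *)
Definition answers S (M : machine S) (w : seq S) (n : nat) (b : bool) : Prop :=
  (forall k, k < n -> tm_halt (cstate (iter k (@step S M) (init M w))) = None) /\
  tm_halt (cstate (iter n (@step S M) (init M w))) = Some b.

(** The problem of testing [yes x], given [x] satisfying [valid] and presented
    as the string [code x], is solvable in polynomial time. *)
Definition poly_time_testable (S : finType) (I : Type) (code : I -> seq S)
    (valid yes : I -> Prop) : Prop :=
  exists (M : machine S) (p : {poly nat}), forall x, valid x ->
    exists (n : nat) (b : bool),
      [/\ n <= (p.[size (code x)])%R, answers M (code x) n b & b <-> yes x].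

Inductive symbol :=
  SVar | SZero | SOne | SEndVar | STop | SBot | SNeg | SAnd | SOr | SImp |
  SItem | SEndList.

Definition symbols : seq symbol :=
  [:: SVar; SZero; SOne; SEndVar; STop; SBot; SNeg; SAnd; SOr; SImp;
      SItem; SEndList].

Definition symbol_rank (s : symbol) : 'I_12 :=
  inord match s with
  | SVar => 0 | SZero => 1 | SOne => 2 | SEndVar => 3 | STop => 4 | SBot => 5
  | SNeg => 6 | SAnd => 7 | SOr => 8 | SImp => 9 | SItem => 10 | SEndList => 11
  end.

Lemma symbol_rankK : cancel symbol_rank (fun i : 'I_12 => nth SVar symbols i).
Proof. by case; rewrite /symbol_rank inordK. Qed.

HB.instance Definition _ := Finite.copy symbol (can_type symbol_rankK).

(** Binary digits, least significant first. *)
Fixpoint code_positive (p : BinNums.positive) : seq symbol :=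
  match p with
  | BinNums.xH => [:: SOne]
  | BinNums.xO q => SZero :: code_positive q
  | BinNums.xI q => SOne :: code_positive q
  end.

Definition code_nat (n : nat) : seq symbol :=
  match bin_of_nat n with
  | BinNums.N0 => [::]
  | BinNums.Npos p => code_positive p
  end.

Fixpoint code_formula (f : formula) : seq symbol :=
  match f with
  | Var q => SVar :: rcons (code_nat q) SEndVar
  | Top => [:: STop]
  | Bot => [:: SBot]
  | Neg g => SNeg :: code_formula g
  | And g h => SAnd :: code_formula g ++ code_formula h
  | Or g h => SOr :: code_formula g ++ code_formula h
  | Imp g h => SImp :: code_formula g ++ code_formula h
  end.

Definition code_default (d : default) : seq symbol :=
  code_formula (prerequisite d) ++ code_formula (justification d) ++
  code_formula (conclusion d).

Definition code_seq (A : Type) (code : A -> seq symbol) (s : seq A) :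
    seq symbol :=
  rcons (flatten [seq SItem :: code a | a <- s]) SEndList.

(** The finite sets [D], [W] and [P] (the latter a set of pairs) are presented
    by listing their elements, in any order. *)
Record instance : Type := Instance {
  query : formula;
  defaults : seq default;
  facts : seq formula;
  priorities : seq (default * default) }.

Definition code_instance (x : instance) : seq symbol :=
  code_formula (query x) ++ code_seq code_default (defaults x) ++
  code_seq code_formula (facts x) ++
  code_seq (fun dd => code_default dd.1 ++ code_default dd.2) (priorities x).

Definition theory_defaults (x : instance) : set default := [set` defaults x].

Definition theory_facts (x : instance) : set formula := [set` facts x].

Definition priority_of (x : instance) : priority :=
  fun d d' => (d, d') \in priorities x.

Definition literal_instance (x : instance) : Prop :=
  [/\ is_literal (query x),
      prereq_free_normal_unary (theory_defaults x),
      (forall f, theory_facts x f -> is_literal f) &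
      strict_partial_order (theory_defaults x) (priority_of x)].

(* Main.v *)
From HB Require Import structures.
From mathcomp Require Import all_classical.
From mathcomp Require Import all_boot all_algebra.
From mathcomp Require Import zify.
Require Import Defs.
Set Implicit Arguments.
Unset Strict Implicit.
Unset Printing Implicit Defensive.

(** Let [l'] be the literal opposite to [l], and write [d_l] for the default
    with conclusion [l].  As long as neither [l] nor [l'] has been derived, the
    default [d_l] is active and blocks everything below it.  Hence, when
    [W] is consistent, every default is eventually decided, [d_l] wins over
    [d_l'] whenever it has higher priority, and otherwise some total order
    extending the priorities makes [d_l'] win; the greedy extension
    of such an order is preferred in both senses.  So under both semantics [l]
    belongs to all preferred extensions iff
    [W] is inconsistent, or [l] is in [W], or [l'] is not in [W], [d_l] is in
    [D], and either [d_l'] is not in [D] or [d_l] has priority over [d_l'].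

    This criterion only compares signs of occurrences of a single variable.  A
    machine with two tapes copies its input to the second tape, and for each
    variable occurrence on the first tape makes one pass over the second,
    comparing variables in place and remembering finitely many signs.  The
    first occurrence is the query; the others serve to detect that [W] is
    inconsistent.  The time is quadratic. *)

(** * The machine *)

Definition literal := (bool * nat)%type.
Definition opposite (l : literal) : literal := (~~ l.1, l.2).
Definition lit_formula (l : literal) : formula :=
  if l.1 then Var l.2 else Neg (Var l.2).
Definition lit_default (l : literal) : default :=
  Default Top (lit_formula l) (lit_formula l).

Inductive place := InQuery | InDefaults | InFacts | InPriorities.

Definition place_rank (s : place) : 'I_4 :=
  inord match s with
  | InQuery => 0 | InDefaults => 1 | InFacts => 2 | InPriorities => 3
  end.

Lemma place_rankK : cancel place_rank
  (fun i : 'I_4 => nth InQuery [:: InQuery; InDefaults; InFacts; InPriorities] i).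
Proof. by case; rewrite /place_rank inordK. Qed.

HB.instance Definition _ := Finite.copy place (can_type place_rankK).

(* What a pass for the variable [v] retains of the string read so far:
   [default_signs] and [fact_signs] are the signs with which [v] occurs in the
   two lists, and [s \in priority_signs] records that the literal of [v] with
   sign [s] has priority over its opposite.  [previous] is the sign of the last
   literal read within the current priority, or [None] if that literal is not
   about [v]. *)
Record memo := Memo {
  place_of : place;
  negated : bool;
  previous : option bool;
  query_sign : bool;
  default_signs : {set bool};
  fact_signs : {set bool};
  priority_signs : {set bool} }.

Definition memo_tuple (m : memo) :=
  (place_of m, negated m, previous m, query_sign m,
   default_signs m, fact_signs m, priority_signs m).

Lemma memo_tupleK : cancel memo_tuple (fun x =>
  let: (w, n, p, q, D, W, P) := x in Memo w n p q D W P).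
Proof. by case. Qed.

HB.instance Definition _ := Finite.copy memo (can_type memo_tupleK).

Definition memo0 := Memo InQuery false None true set0 set0 set0.

Definition read_symbol (m : memo) (s : symbol) : memo :=
  let: Memo w n p q D W P := m in
  match s with
  | SNeg => Memo w true p q D W P
  | SItem =>
      Memo (if w is InQuery then InDefaults else w) n None q D W P
  | SEndList =>
      Memo (match w with
            | InQuery | InDefaults => InFacts
            | InFacts | InPriorities => InPriorities
            end) n p q D W P
  | _ => m
  end.

(* In a priority each of the two defaults contributes its literal twice in a row;
   a change of sign can thus only occur between the two defaults. *)
Definition read_var (m : memo) (same : bool) : memo :=
  let: Memo w n p q D W P := m in
  let s := ~~ n in
  let add (A : {set bool}) := if same then s |: A else A in
  match w with
  | InQuery => Memo w false p s D W P
  | InDefaults => Memo w false p q (add D) W P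
  | InFacts => Memo w false p q D (add W) P
  | InPriorities =>
      Memo w false (if same then Some s else None) q D W
        (if same && (p == Some (~~ s)) then ~~ s |: P else P)
  end.

(** The first disjunct detects complementary facts about the variable of the pass. The second is the
    criterion for the query; it makes sense only in the first pass, whose variable is the one of the
    query. *)
Definition verdict (first : bool) (m : memo) : bool :=
  let: Memo _ _ _ s D W P := m in
  ((true \in W) && (false \in W)) ||
  first && ((s \in W) ||
    [&& ~~ s \notin W, s \in D & (~~ s \notin D) || (s \in P)]).

Inductive control :=
  Copy | Rewind | Seek | Scan | Compare | Skip | Back | Return | Accept | Reject.

Definition controls :=
  [:: Copy; Rewind; Seek; Scan; Compare; Skip; Back; Return; Accept; Reject].

Definition control_rank (s : control) : 'I_10 :=
  inord match s with
  | Copy => 0 | Rewind => 1 | Seek => 2 | Scan => 3 | Compare => 4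
  | Skip => 5 | Back => 6 | Return => 7 | Accept => 8 | Reject => 9
  end.

Lemma control_rankK : cancel control_rank (fun i : 'I_10 => nth Copy controls i).
Proof. by case; rewrite /control_rank inordK. Qed.

HB.instance Definition _ := Finite.copy control (can_type control_rankK).

Definition state := (control * bool * memo)%type.
Notation letter := (option (symbol + void)).

(* [Seek] looks for the next variable on tape 0.  During a pass the head of tape 0
   rests on its [SVar], to which [Back] returns after each comparison; [Return]
   rewinds tape 1 after a pass. *)
Definition transition (q : state) (a b : letter) : state * move * move :=
  let: (k, first, m) := q in
  match k with
  | Copy =>
      if a is Some _ then (q, MoveRight, MoveRight)
      else ((Rewind, first, m), MoveLeft, MoveLeft)
  | Rewind =>
      if a is Some _ then (q, MoveLeft, MoveLeft)
      else ((Seek, first, m), MoveRight, MoveRight)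
  | Seek =>
      match a with
      | None => ((Reject, first, m), Stay, Stay)
      | Some (inl SVar) => ((Scan, first, memo0), Stay, Stay)
      | Some _ => (q, MoveRight, Stay)
      end
  | Scan =>
      match b with
      | None => ((if verdict first m then Accept else Return, first, m),
                 Stay, MoveLeft)
      | Some (inl SVar) => ((Compare, first, m), MoveRight, MoveRight)
      | Some (inl s) => ((Scan, first, read_symbol m s), Stay, MoveRight)
      | Some (inr _) => (q, Stay, Stay)
      end
  | Compare =>
      if a == b then
        if b is Some (inl SEndVar) then
          ((Back, first, read_var m true), Stay, MoveRight)
        else (q, MoveRight, MoveRight)
      else ((Skip, first, m), Stay, Stay)
  | Skip =>
      if b is Some (inl SEndVar) then
        ((Back, first, read_var m false), Stay, MoveRight)
      else (q, Stay, MoveRight)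
  | Back =>
      if a is Some (inl SVar) then ((Scan, first, m), Stay, Stay)
      else (q, MoveLeft, Stay)
  | Return =>
      if b is Some _ then (q, Stay, MoveLeft)
      else ((Seek, false, m), MoveRight, MoveRight)
  | Accept | Reject => (q, Stay, Stay)
  end.

Definition written (q : state) (a b : letter) : letter :=
  if q.1.1 is Copy then a else b.

Definition halt (q : state) : option bool :=
  match q.1.1 with Accept => Some true | Reject => Some false | _ => None end.

Definition copy_tape : 'I_2 := lift ord0 ord0.

Definition decider : machine symbol :=
  @Machine symbol 1 void state (Copy, true, memo0) halt
    (fun x => let: (q, h) := x in
       let: (q', m0, m1) := transition q (h ord0) (h copy_tape) in
       (q', [ffun i => if i == ord0 then h ord0
                       else written q (h ord0) (h copy_tape)],
        fun i => if i == ord0 then m0 else m1)).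

(** * Runs of a machine and bounds on their length *)

Section Runs.
Variables (S : finType) (M : machine S).

Fixpoint run (n : nat) (c c' : config M) : Prop :=
  if n is k.+1 then tm_halt (cstate c) = None /\ run k (step c) c' else c = c'.

Lemma run_trans n k c1 c2 c3 : run n c1 c2 -> run k c2 c3 -> run (n + k) c1 c3.
Proof.
elim: n c1 => [|n IH] c1 /=; first by move->.
by case=> h r r'; split=> //; apply: IH.
Qed.

Lemma run_answers w n b c' : run n (init M w) c' ->
  tm_halt (cstate c') = Some b -> answers M w n b.
Proof.
rewrite /answers; elim: n (init M w) => [|n IH] c /=; first by move=> -> .
case=> h /IH {}IH /IH [ih1 ih2]; split=> [[|k] // kn|]; rewrite -?iterS iterSr //.
exact: ih1.
Qed.

(** [n] is an upper bound, so that bounds for successive phases add up with slack and phases ending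
    after different numbers of steps share one statement. *)
Definition reach n (A B : config M -> Prop) :=
  forall c, A c -> exists k c', [/\ k <= n, run k c c' & B c'].

Lemma reach_refl n A : reach n A A.
Proof. by move=> c Ac; exists 0, c. Qed.

Lemma reach_trans n k l (A B C : config M -> Prop) : reach n A B -> reach k B C ->
  n + k <= l -> reach l A C.
Proof.
move=> AB BC le c /AB [i [c' [ni r /BC [j [c'' [kj r' Cc]]]]]].
exists (i + j), c''; split=> //; last exact: run_trans r r'.
by rewrite (leq_trans _ le) // leq_add.
Qed.

Lemma reach_le n k (A B : config M -> Prop) : reach n A B -> n <= k -> reach k A B.
Proof. by move=> AB nk; apply: (reach_trans AB (@reach_refl 0 B)); rewrite addn0. Qed.

End Runs.

(* Head moves create and destroy blanks at the ends of the two lists of a tape,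
   so tapes are described only up to trailing blanks. *)
Definition same_cells (a b : seq letter) := forall i, nth None a i = nth None b i.

Definition view := (seq letter * seq letter)%type.

Definition holds (t : tape letter) (v : view) :=
  same_cells (tleft t) v.1 /\ same_cells (thead t :: tright t) v.2.

Definition seen (v : view) : letter := head None v.2.

Definition moved (m : move) (v : view) : view :=
  match m with
  | MoveLeft => (behead v.1, head None v.1 :: v.2)
  | Stay => v
  | MoveRight => (head None v.2 :: v.1, behead v.2)
  end.

Definition overwrite (b : letter) (v : view) : view := (v.1, b :: behead v.2).

Lemma nth_behead (a : seq letter) i : nth None (behead a) i = nth None a i.+1.
Proof. by case: a => //=; rewrite nth_nil. Qed.

Lemma head_nth (a : seq letter) : head None a = nth None a 0.
Proof. by case: a. Qed.

Lemma holds_seen t v : holds t v -> thead t = seen v.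
Proof. by case=> _ /(_ 0) /= ->; rewrite /seen head_nth. Qed.

Lemma holds_moved t v b m : holds t v ->
  holds (write_move t b m) (moved m (overwrite b v)).
Proof.
move=> [hl hr]; case: m; split=> -[|i] //=;
  rewrite ?nth_behead ?head_nth ?hl //; try by rewrite -hr.
all: case: i => [|i] //=; rewrite ?nth_behead -?hr //.
Qed.

(** Writing back the scanned letter changes a view at most by making an implicit blank explicit,
    which [same_cells] ignores. *)
Lemma holds_rewritten t v m : holds t v ->
  holds (write_move t (thead t) m) (moved m v).
Proof.
move=> h; have := holds_moved (thead t) m h; rewrite (holds_seen h).
case: v h => l [|x r] //= _; rewrite /overwrite /seen; case: m => //= -[hl hr].
- by split=> // i; have /= -> := hr i; case: i => [|[|i]] //=; rewrite nth_nil.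
- by split=> // i; have /= -> := hr i; case: i => [|i] //=; rewrite nth_nil.
Qed.

Definition at_ (q : state) (v0 v1 : view) (c : config decider) :=
  [/\ cstate c = q, holds (ctape c ord0) v0 & holds (ctape c copy_tape) v1].

Lemma step_at q v0 v1 c : at_ q v0 v1 c ->
  let: (q', m0, m1) := transition q (seen v0) (seen v1) in
  at_ q' (moved m0 v0)
    (moved m1 (if q.1.1 is Copy then overwrite (seen v0) v1 else v1)) (step c).
Proof.
case: c => q1 t [/= -> h0 h1]; rewrite /step /= !ffunE (holds_seen h0) (holds_seen h1).
case: transition => [[q' m0] m1]; split=> //=; rewrite !ffunE /=.
  by rewrite -(holds_seen h0); apply: holds_rewritten.
rewrite /written; case: q.1.1; try by rewrite -(holds_seen h1); apply: holds_rewritten.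
exact: holds_moved.
Qed.

Lemma reach_step n q v0 v1 B : halt q = None ->
  (let: (q', m0, m1) := transition q (seen v0) (seen v1) in
   reach n (at_ q' (moved m0 v0)
     (moved m1 (if q.1.1 is Copy then overwrite (seen v0) v1 else v1))) B) ->
  reach n.+1 (at_ q v0 v1) B.
Proof.
move=> hq R c cA; move: (step_at cA) R; case: transition => [[q' m0] m1].
move=> cA' /(_ _ cA') [k [c' [kn r Bc]]]; exists k.+1, c'; split=> //=.
by case: cA => ->.
Qed.

Lemma reach_same n q l0 r0 l1 r1 l0' r0' l1' r1' B :
  same_cells l0 l0' -> same_cells r0 r0' -> same_cells l1 l1' -> same_cells r1 r1' ->
  reach n (at_ q (l0', r0') (l1', r1')) B -> reach n (at_ q (l0, r0) (l1, r1)) B.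
Proof.
move=> e0 f0 e1 f1 R c [cq [/= a0 b0] [/= a1 b1]]; apply: R; split=> //;
  split=> i /=; rewrite ?a0 ?b0 ?a1 ?b1 ?e0 ?f0 ?e1 ?f1 //.
Qed.

(** * Tokens and their codes *)

Definition letters (w : seq symbol) : seq letter := [seq Some (inl s) | s <- w].

Definition token := (symbol + nat)%type.

Definition token_code (t : token) : seq symbol :=
  match t with
  | inl s => [:: s]
  | inr q => SVar :: rcons (code_nat q) SEndVar
  end.

Definition code_tokens (ts : seq token) := flatten (map token_code ts).

Definition is_bit (s : symbol) := if s is (SZero | SOne) then true else false.

Lemma code_positive_bits p : all is_bit (code_positive p).
Proof. by elim: p. Qed.

Lemma code_nat_bits n : all is_bit (code_nat n).
Proof. by rewrite /code_nat; case: bin_of_nat => // p; apply: code_positive_bits. Qed.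

Lemma code_positive_nonempty p : code_positive p <> [::].
Proof. by case: p. Qed.

Lemma code_positive_inj : injective code_positive.
Proof.
elim=> [p IH|p IH|] [r|r|] //= [].
- by move/IH->.
- by move/code_positive_nonempty.
- by move/IH->.
- by move/esym/code_positive_nonempty.
Qed.

Lemma code_nat_inj : injective code_nat.
Proof.
move=> n k e; apply: (can_inj bin_of_natK); move: e; rewrite /code_nat.
case: (bin_of_nat n) (bin_of_nat k) => [|p] [|r] //=.
- by move/esym/code_positive_nonempty.
- by move/code_positive_nonempty.
- by move/code_positive_inj->.
Qed.

Lemma letters_cat u v : letters (u ++ v) = letters u ++ letters v.
Proof. exact: map_cat. Qed.

Lemma letters_rcons u s : letters (rcons u s) = letters u ++ [:: Some (inl s)].
Proof. by rewrite -cats1 letters_cat. Qed.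

(** * Running times of the phases of the machine *)

Definition not_var (a : letter) := if a is Some (inl SVar) then false else true.

Lemma bits_not_var u : all is_bit u -> all not_var (letters u).
Proof. by rewrite all_map; apply: sub_all => -[]. Qed.

(** One step for [h], one for each letter of [z], and one to recognise the mark, on which the head
    stays. *)
Lemma reach_back first m z h r L0 v1 : all not_var z -> not_var h ->
  reach (size z).+2 (at_ (Back, first, m) (z ++ Some (inl SVar) :: L0, h :: r) v1)
    (at_ (Scan, first, m) (L0, Some (inl SVar) :: catrev z (h :: r)) v1).
Proof.
have back_step n l x r' B : not_var x ->
    reach n (at_ (Back, first, m) (behead l, head None l :: x :: r') v1) B ->
    reach n.+1 (at_ (Back, first, m) (l, x :: r') v1) B.
  by move=> xn R; apply: reach_step => //; case: x xn R => [[[]|]|].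
elim: z h r => [|x z IH] h r /= => [_|/andP[xn zn]] hn.
- apply: back_step => //=; apply: reach_step => //=.
  by apply: reach_refl.
- by apply: back_step => //; apply: IH.
Qed.

Notation var_mark := (Some (inl SVar) : letter).
Notation end_mark := (Some (inl SEndVar) : letter).

Lemma reach_skip first m b v0 l1 r1 : all is_bit b ->
  reach (size b).+1
    (at_ (Skip, first, m) v0 (l1, letters b ++ end_mark :: r1))
    (at_ (Back, first, read_var m false) v0 (end_mark :: catrev (letters b) l1, r1)).
Proof.
elim: b l1 => [|y b IH] l1 /= => [_|/andP[yb bb]].
  by apply: reach_step => //; apply: reach_refl.
by apply: reach_step => //; case: y yb => //= _; apply: IH.
Qed.

(** [z] generalises the induction: it is the matched prefix on tape 0, which [Back] walks over
    again; hence two steps for each bit of [b]. The end mark is not a bit, so a proper prefix also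
    counts as a mismatch. *)
Lemma reach_compare first m a b z L0 R0 l1 r1 :
  all is_bit a -> all is_bit b -> all not_var z ->
  reach (2 * size b + size z + 4)
    (at_ (Compare, first, m) (z ++ var_mark :: L0, letters a ++ end_mark :: R0)
       (l1, letters b ++ end_mark :: r1))
    (at_ (Scan, first, read_var m (a == b))
       (L0, var_mark :: catrev z (letters a ++ end_mark :: R0))
       (end_mark :: catrev (letters b) l1, r1)).
Proof.
elim: b a z l1 => [|y b IH] [|x a] z l1 /=.
- move=> _ _ zn; rewrite addn4; apply: reach_step => //=; rewrite /seen /= eqxx /=.
  by apply: (reach_le (reach_back zn _)) => //; lia.
- case/andP=> xb ab _ zn; rewrite addn4; apply: reach_step => //=; rewrite /seen /=.
  case: eqP => [[]|_]; first by case: x xb.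
  apply: (reach_trans (@reach_skip first m [::] _ _ _ isT) (reach_back zn _)) => //=.
    by case: x xb.
- move=> _ /andP[yb bb] zn; rewrite addn4; apply: reach_step => //=; rewrite /seen /=.
  case: eqP => [[]|_]; first by case: y yb.
  apply: (@reach_trans _ _ _ _ _ _ _ _
    (@reach_skip first m (y :: b) _ _ _ _) (reach_back zn _)) => //=.
    by rewrite yb.
  lia.
- case/andP=> xb ab /andP[yb bb] zn; rewrite addn4; apply: reach_step => //=; rewrite /seen /=.
  rewrite eqseq_cons; case: eqP => [[<-]|ne].
    have R := IH a (Some (inl x) :: z) (Some (inl x) :: l1) ab bb.
    by rewrite !eqxx /=; case: x xb yb R => //= _ _ R; apply: (reach_le (R zn)); lia.
  have -> : (x == y) = false by apply/eqP => e; apply: ne; rewrite e.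
  apply: (@reach_trans _ _ _ _ _ _ _ _
    (@reach_skip first m (y :: b) _ _ _ _) (reach_back zn _)) => //=.
  + by rewrite yb.
  + by case: x xb {ne}.
  + lia.
Qed.

(** Excludes a bare [SVar], so that on the tape this symbol always opens a complete variable. *)
Definition plain (t : token) := if t is inl SVar then false else true.

Definition read_token (q : nat) (m : memo) (t : token) : memo :=
  match t with inl s => read_symbol m s | inr q' => read_var m (q == q') end.

Lemma catrev_cat (T : Type) (a b c : seq T) : catrev (a ++ b) c = catrev b (catrev a c).
Proof. by elim: a c => /=. Qed.

Lemma reach_scan first q m ts L0 R0 l1 : all plain ts ->
  reach (3 * size (code_tokens ts))
    (at_ (Scan, first, m) (L0, letters (token_code (inr q)) ++ R0)
       (l1, letters (code_tokens ts)))
    (at_ (Scan, first, foldl (read_token q) m ts)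
       (L0, letters (token_code (inr q)) ++ R0)
       (catrev (letters (code_tokens ts)) l1, [::])).
Proof.
elim: ts m l1 => [|[s|q'] ts IH] m l1 /=; first by move=> _; apply: reach_refl.
- case/andP=> sp tsp; rewrite mulnS addSn; apply: reach_step => //.
  case: s sp => //= _; apply: (reach_le (IH _ _ tsp)); rewrite /code_tokens; lia.
- move=> tsp; rewrite mulnS addSn; apply: reach_step => //=.
  rewrite cat_rcons !letters_cat /= letters_rcons -catA /=.
  have := @reach_compare first m (code_nat q) (code_nat q') [::] L0 R0
    (var_mark :: l1) (letters (code_tokens ts))
    (code_nat_bits q) (code_nat_bits q') isT.
  rewrite (inj_eq code_nat_inj) catrev_cat /= => cmp.
  have := IH (read_var m (q == q'))
    (end_mark :: catrev (letters (code_nat q')) (var_mark :: l1)) tsp.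
  rewrite /= letters_rcons -catA /= => scan.
  apply: (reach_trans cmp scan); rewrite !size_cat /= /code_tokens; lia.
Qed.

(** The split of [letters u] by [head] and [behead] is what a left move produces, and it also covers
    an empty [u], where the head already scans a blank. *)
Lemma reach_return first m u l0 a r0 r1 :
  reach (size u).+1
    (at_ (Return, first, m) (l0, a :: r0)
       (behead (letters u), head None (letters u) :: r1))
    (at_ (Seek, false, m) (a :: l0, r0) ([:: None], catrev (letters u) r1)).
Proof.
elim: u r1 => [|s u IH] r1 /=; apply: reach_step => //=.
exact: reach_refl.
Qed.

Lemma reach_rewind first m u r0 r1 :
  reach (size u).+1
    (at_ (Rewind, first, m) (behead (letters u), head None (letters u) :: r0)
       (behead (letters u), head None (letters u) :: r1))
    (at_ (Seek, first, m) ([:: None], catrev (letters u) r0)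
       ([:: None], catrev (letters u) r1)).
Proof.
elim: u r0 r1 => [|s u IH] r0 r1 /=; apply: reach_step => //=.
exact: reach_refl.
Qed.

Lemma reach_copy first m u l0 l1 :
  reach (size u).+1
    (at_ (Copy, first, m) (l0, letters u) (l1, [::]))
    (at_ (Rewind, first, m)
       (moved MoveLeft (catrev (letters u) l0, [::]))
       (moved MoveLeft (catrev (letters u) l1, [:: None]))).
Proof.
elim: u l0 l1 => [|s u IH] l0 l1 /=; apply: reach_step => //=.
exact: reach_refl.
Qed.

Lemma reach_pass first m u l0 r0 v1 : all not_var (letters u) ->
  reach (size u) (at_ (Seek, first, m) (l0, letters u ++ r0) v1)
    (at_ (Seek, first, m) (catrev (letters u) l0, r0) v1).
Proof.
elim: u l0 => [|s u IH] l0 /=; first by move=> _; apply: reach_refl.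
case/andP=> sn un; apply: reach_step => //.
by case: s sn => //= _; apply: IH.
Qed.

Lemma same_blank : same_cells [:: None] [::].
Proof. by case=> [|i] //=; rewrite nth_nil. Qed.

Lemma same_refl a : same_cells a a.
Proof. by []. Qed.

Definition answering b (c : config decider) := tm_halt (cstate c) = Some b.

Definition scanned q ts := foldl (read_token q) memo0 ts.

Lemma catrev_rev (T : Type) (a b : seq T) : catrev (rev a) b = a ++ b.
Proof. by rewrite catrevE revK. Qed.

(** [b] is the time for whatever follows a negative verdict. The pass itself costs one step to enter
    it, three per symbol of the copy, one for the verdict, and the rewinding of tape 1. *)
Lemma reach_test first q m ts L0 R0 b B : all plain ts ->
  (if verdict first (scanned q ts) then B = answering true else
   reach b (at_ (Seek, false, scanned q ts)
       (var_mark :: L0, letters (rcons (code_nat q) SEndVar) ++ R0)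
       ([::], letters (code_tokens ts))) B) ->
  reach (4 * size (code_tokens ts) + 3 + b)
    (at_ (Seek, first, m) (L0, letters (token_code (inr q)) ++ R0)
       ([::], letters (code_tokens ts))) B.
Proof.
move=> tsp H.
have -> : 4 * size (code_tokens ts) + 3 + b = (4 * size (code_tokens ts) + 2 + b).+1.
  by lia.
apply: reach_step => //=.
apply: (reach_trans (k := (size (code_tokens ts) + b).+2)
  (@reach_scan first q memo0 ts L0 R0 [::] tsp)); last lia.
apply: reach_step => //=; move: H; rewrite -/(scanned q ts).
case: verdict => [-> c [cq _ _]|R].
  by exists 0, c; split=> //; rewrite /answering /= cq.
have -> : catrev (letters (code_tokens ts)) [::] = letters (rev (code_tokens ts)).
  by rewrite catrevE cats0 /letters map_rev.
apply: (reach_trans (@reach_return first (scanned q ts) _ L0 var_mark _ [::])).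
  rewrite /letters map_rev catrev_rev cats0.
  apply: reach_same R; by [apply: same_blank|].
by rewrite size_rev addSn.
Qed.

(** The outer loop of the machine: [ts] is the full copy on tape 1 and [us] the part of tape 0 still
    to be visited. *)
Fixpoint search (first : bool) (ts us : seq token) : bool :=
  match us with
  | [::] => false
  | inl _ :: us' => search first ts us'
  | inr q :: us' => verdict first (scanned q ts) || search false ts us'
  end.

Lemma reach_search first m ts us L0 : all plain ts -> all plain us ->
  reach (size (code_tokens us) * (4 * size (code_tokens ts) + 5)).+1
    (at_ (Seek, first, m) (L0, letters (code_tokens us))
       ([::], letters (code_tokens ts)))
    (answering (search first ts us)).
Proof.
move=> tsp; elim: us first m L0 => [|[s|q] us IH] first m L0 /=.
- by move=> _; apply: reach_step => // c [cq _ _]; exists 0, c;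
    split; rewrite // /answering /= cq.
- case/andP=> sp usp; apply: reach_step => //; case: s sp => //= _;
    by apply: (reach_le (IH _ _ _ usp)); rewrite /code_tokens mulSn; lia.
- move=> usp; rewrite cat_rcons letters_cat.
  pose b := (size (code_nat q)).+1 +
    (size (code_tokens us) * (4 * size (code_tokens ts) + 5)).+1.
  have := @reach_test first q m ts L0 (letters (code_tokens us)) b
    (answering (verdict first (scanned q ts) || search false ts us)) tsp.
  rewrite /= letters_rcons -catA /= => R.
  apply: (reach_le (R _)); last by rewrite size_cat /= /b /code_tokens; nia.
  case: verdict {R} => //=.
  rewrite /b -(size_rcons _ SEndVar) -(cat1s end_mark) catA -letters_rcons.
  apply: (reach_trans (reach_pass _) (IH _ _ _ usp)); last exact: leqnn.
  by rewrite letters_rcons all_cat bits_not_var ?code_nat_bits.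
Qed.

Lemma init_at w : at_ (Copy, true, memo0) ([::], letters w) ([::], [::]) (init decider w).
Proof.
split=> //; split=> // i /=; last by case: i => [|i] //=; rewrite nth_nil.
by rewrite -[in RHS]/(letters w); case: w => [|s w] //=; case: i => [|i] //=; rewrite nth_nil.
Qed.

Lemma decider_answers ts : all plain ts -> exists n,
  n <= 4 * (size (code_tokens ts)).+1 ^ 2 /\
  answers decider (code_tokens ts) n (search true ts ts).
Proof.
move=> tsp; set w := code_tokens ts.
have R : reach (4 * (size w).+1 ^ 2)
    (at_ (Copy, true, memo0) ([::], letters w) ([::], [::]))
    (answering (search true ts ts)).
  apply: (reach_trans (k := 4 * (size w).+1 ^ 2 - (size w).+1)
    (@reach_copy true memo0 w [::] [::])); last lia.
  have -> : catrev (letters w) [::] = letters (rev w).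
    by rewrite catrevE cats0 /letters map_rev.
  apply: (reach_trans (@reach_rewind true memo0 (rev w) [::] [:: None])).
    rewrite /letters map_rev !catrev_rev cats0.
    apply: (reach_same _ _ _ _ (@reach_search true memo0 ts ts [::] tsp tsp));
      try exact: same_blank; try exact: same_refl.
    (* The last step of [Copy] writes an explicit blank behind the copy on tape 1. *)
    move=> i; rewrite nth_cat; case: ltnP => // h; rewrite [RHS]nth_default //.
    by rewrite same_blank nth_nil.
  rewrite size_rev -/w; nia.
have [n [c [le r h]]] := R _ (init_at w).
by exists n; split=> //; apply: run_answers r h.
Qed.

(** * Instances as strings of literals *)

Definition lit_tokens (l : literal) : seq token :=
  if l.1 then [:: inr l.2] else [:: inl SNeg; inr l.2].

Definition default_tokens (l : literal) : seq token :=
  inl STop :: lit_tokens l ++ lit_tokens l.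

Definition priority_tokens (p : literal * literal) : seq token :=
  default_tokens p.1 ++ default_tokens p.2.

Definition seq_tokens (A : Type) (tokens : A -> seq token) (s : seq A) : seq token :=
  rcons (flatten [seq inl SItem :: tokens a | a <- s]) (inl SEndList).

Definition instance_tokens l D W P : seq token :=
  lit_tokens l ++ seq_tokens default_tokens D ++
  seq_tokens lit_tokens W ++ seq_tokens priority_tokens P.

Definition lit_instance l D W P : instance :=
  Instance (lit_formula l) (map lit_default D) (map lit_formula W)
    [seq (lit_default p.1, lit_default p.2) | p <- P].

Lemma code_tokens_cat u v : code_tokens (u ++ v) = code_tokens u ++ code_tokens v.
Proof. by rewrite /code_tokens map_cat flatten_cat. Qed.

Lemma code_lit_tokens l : code_tokens (lit_tokens l) = code_formula (lit_formula l).
Proof. by case: l => [[]] n; rewrite /code_tokens /= cats0. Qed.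

Lemma code_default_tokens l :
  code_tokens (default_tokens l) = code_default (lit_default l).
Proof. by rewrite /code_default /= -code_lit_tokens -code_tokens_cat. Qed.

Lemma code_seq_tokens (A B : Type) (f : A -> B) tokens (code : B -> seq symbol) s :
  (forall a, code_tokens (tokens a) = code (f a)) ->
  code_tokens (seq_tokens tokens s) = code_seq code (map f s).
Proof.
move=> e; rewrite /seq_tokens /code_seq -!cats1 code_tokens_cat; congr (_ ++ _).
elim: s => //= a s IH; by rewrite -e -IH -code_tokens_cat.
Qed.

Lemma code_instance_tokens l D W P :
  code_tokens (instance_tokens l D W P) = code_instance (lit_instance l D W P).
Proof.
rewrite !code_tokens_cat code_lit_tokens.
rewrite (code_seq_tokens _ code_default_tokens) (code_seq_tokens _ code_lit_tokens).
rewrite (@code_seq_tokens _ _ (fun p => (lit_default p.1, lit_default p.2)) _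
  (fun dd => code_default dd.1 ++ code_default dd.2)) // => p.
by rewrite code_tokens_cat !code_default_tokens.
Qed.

Lemma plain_lit_tokens l : all plain (lit_tokens l).
Proof. by case: l => [[]]. Qed.

Lemma plain_default_tokens l : all plain (default_tokens l).
Proof. by rewrite /= all_cat plain_lit_tokens. Qed.

Lemma plain_seq_tokens (A : Type) (tokens : A -> seq token) s :
  (forall a, all plain (tokens a)) -> all plain (seq_tokens tokens s).
Proof.
by move=> h; rewrite all_rcons /=; elim: s => //= a s IH; rewrite all_cat h.
Qed.

Lemma plain_instance_tokens l D W P : all plain (instance_tokens l D W P).
Proof.
rewrite !all_cat plain_lit_tokens !plain_seq_tokens //.
- by move=> p; rewrite all_cat !plain_default_tokens.
- exact: plain_lit_tokens.
- exact: plain_default_tokens.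
Qed.

(** * What a pass retains of an instance *)

Definition signs (v : nat) (s : seq literal) : {set bool} :=
  finset (fun b => (b, v) \in s).

Definition priority_signs_of (v : nat) (s : seq (literal * literal)) : {set bool} :=
  finset (fun b => ((b, v), (~~ b, v)) \in s).

Lemma signs_cons v l s :
  signs v (l :: s) = if v == l.2 then l.1 |: signs v s else signs v s.
Proof.
case: l => c k; apply/setP => b; rewrite inE in_cons xpair_eqE /=.
by case: (v =P k) => [->|_]; rewrite !inE ?andbT ?andbF.
Qed.

Lemma read_lit v n p q D W P l :
  foldl (read_token v) (Memo n false p q D W P) (lit_tokens l) =
  match n with
  | InQuery => Memo n false p l.1 D W P
  | InDefaults => Memo n false p q (if v == l.2 then l.1 |: D else D) W P
  | InFacts => Memo n false p q D (if v == l.2 then l.1 |: W else W) P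
  | InPriorities =>
      Memo n false (if v == l.2 then Some l.1 else None) q D W
        (if (v == l.2) && (p == Some (~~ l.1)) then ~~ l.1 |: P else P)
  end.
Proof. by case: l => [[]] k; case: n. Qed.

(** The list is entered from [InQuery], which its first [SItem] leaves, or its [SEndList] if it is
    empty. Each literal is read twice, which is harmless as adding a sign is idempotent. *)
Lemma read_defaults v s n p q D W P : n = InQuery \/ n = InDefaults ->
  exists p', foldl (read_token v) (Memo n false p q D W P)
    (seq_tokens default_tokens s) = Memo InFacts false p' q (D :|: signs v s) W P.
Proof.
rewrite /seq_tokens -cats1 foldl_cat /=; elim: s n p D => [|l s IH] n p D nE /=.
  have -> : signs v [::] = finset.set0 by apply/setP => b; rewrite !inE.
  by exists p; rewrite setU0; case: nE => ->.
have -> : (if n is InQuery then InDefaults else n) = InDefaults by case: nE => ->.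
rewrite !(foldl_cat, read_lit) signs_cons /=.
set D' := (X in foldl _ (Memo _ _ _ _ X _ _)).
have [|p' ->] := IH InDefaults None D'; first by right.
exists p'; congr Memo; rewrite /D'; apply/setP => b.
by case: eqP => _; rewrite !inE //; case: (b == l.1); case: (b \in D).
Qed.

Lemma read_facts v s p q D W P : exists p',
  foldl (read_token v) (Memo InFacts false p q D W P) (seq_tokens lit_tokens s) =
  Memo InPriorities false p' q D (W :|: signs v s) P.
Proof.
rewrite /seq_tokens -cats1 foldl_cat /=; elim: s p W => [|l s IH] p W /=.
  have -> : signs v [::] = set0 by apply/setP => b; rewrite !inE.
  by exists p; rewrite setU0.
rewrite foldl_cat read_lit signs_cons /=.
set W' := (X in foldl _ (Memo _ _ _ _ _ X _)); have [p' ->] := IH None W'.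
exists p'; congr Memo; rewrite /W'; apply/setP => b.
by case: eqP => _; rewrite !inE //; case: (b == l.1); case: (b \in W).
Qed.

Lemma read_priorities v s p q D W P : exists p',
  foldl (read_token v) (Memo InPriorities false p q D W P)
    (seq_tokens priority_tokens s) =
  Memo InPriorities false p' q D W (P :|: priority_signs_of v s).
Proof.
rewrite /seq_tokens -cats1 foldl_cat /=; elim: s p P => [|[l l'] s IH] p P /=.
  have -> : priority_signs_of v [::] = set0 by apply/setP => b; rewrite !inE.
  by exists p; rewrite setU0.
rewrite !(foldl_cat, read_lit) /= !(foldl_cat, read_lit).
set P' := (X in foldl _ (Memo _ _ _ _ _ _ X)).
set p1 := (X in foldl _ (Memo _ _ X _ _ _ _)).
have [p' ->] := IH p1 P'; exists p'; congr Memo; rewrite /P' {P' p1 IH}.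
apply/setP => b; rewrite !inE /=.
case: l l' => [c k] [c' k']; rewrite !xpair_eqE /=.
(* What one priority adds depends only on which of its two literals are about [v] and on their
   signs. *)
by case: (v == k); case: (v == k'); case: c; case: c'; case: b;
  rewrite /= ?inE; do ?case: (_ \in _).
Qed.

Lemma scanned_instance v l D W P : exists n p,
  scanned v (instance_tokens l D W P) =
  Memo n false p l.1 (signs v D) (signs v W) (priority_signs_of v P).
Proof.
rewrite /scanned /instance_tokens !foldl_cat read_lit.
have [|p1 ->] := @read_defaults v D InQuery None l.1 set0 set0 set0; first by left.
have [p2 ->] := read_facts v W p1 l.1 (set0 :|: signs v D) set0 set0.
have [p3 ->] := read_priorities v P p2 l.1 (set0 :|: signs v D) (set0 :|: signs v W) set0.
by exists InPriorities, p3; rewrite !set0U.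
Qed.

(** The criterion on lists of literals, as the machine decides it. *)
Definition sure (l : literal) (D W : seq literal) (P : seq (literal * literal)) : Prop :=
  [\/ exists v, (true, v) \in W /\ (false, v) \in W,
      l \in W |
      [/\ opposite l \notin W, l \in D & opposite l \notin D \/ (l, opposite l) \in P]].

Lemma search_false ts us : search false ts us <->
  exists2 v, inr v \in us & verdict false (scanned v ts).
Proof.
elim: us => [|[s|q] us IH] /=; first by split=> // -[].
- by rewrite IH; split=> -[v vu h]; exists v => //; move: vu; rewrite in_cons.
- split.
    case/orP=> [h|/IH[v vu h]]; first by exists q; rewrite ?mem_head.
    by exists v; rewrite // in_cons vu orbT.
  case=> v; rewrite in_cons => /orP[/eqP[->] ->//|vu h].
  by apply/orP; right; apply/IH; exists v.
Qed.

Lemma verdict_mono m : verdict false m -> verdict true m.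
Proof. by case: m => n neg p q D W P; rewrite /verdict orbF => ->. Qed.

(** The query comes first, so the first pass is about its variable. Counting this pass again among
    those that test only consistency changes nothing, by [verdict_mono]. *)
Lemma search_true l us ts : search true ts (lit_tokens l ++ us) <->
  verdict true (scanned l.2 ts) \/ search false ts (lit_tokens l ++ us).
Proof.
have E b : search b ts (lit_tokens l ++ us) =
    verdict b (scanned l.2 ts) || search false ts us by case: l => [[]].
rewrite !E; split=> [/orP[->|->]|[->|/orP[/verdict_mono->|->]]]; rewrite ?orbT //; by [left|right].
Qed.

Lemma var_in_instance b v l D W P : (b, v) \in W -> inr v \in instance_tokens l D W P.
Proof.
move=> vW; rewrite !mem_cat; apply/orP; right; apply/orP; right; apply/orP; left.
rewrite mem_rcons in_cons /=; apply/flattenP.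
exists (inl SItem :: lit_tokens (b, v)); first by apply/mapP; exists (b, v).
by case: b {vW}; rewrite !inE eqxx ?orbT.
Qed.

Lemma search_instance l D W P :
  search true (instance_tokens l D W P) (instance_tokens l D W P) <-> sure l D W P.
Proof.
set ts := instance_tokens l D W P.
have vfalse v : verdict false (scanned v ts) <-> (true, v) \in W /\ (false, v) \in W.
  have [n [p ->]] := scanned_instance v l D W P; rewrite /verdict !inE orbF.
  by split=> /andP.
have vtrue : verdict true (scanned l.2 ts) <->
    [\/ (true, l.2) \in W /\ (false, l.2) \in W, l \in W |
      [/\ opposite l \notin W, l \in D & opposite l \notin D \/ (l, opposite l) \in P]].
  have [n [p ->]] := scanned_instance l.2 l D W P; rewrite /verdict !inE /=.
  rewrite -surjective_pairing -/(opposite l); split.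
    case/orP=> [/andP h|/orP[h|/and3P[h1 h2 /orP h3]]];
      [exact: Or31|exact: Or32|exact: Or33].
  case=> [/andP->//|->|[-> -> /orP->]]; rewrite ?orbT //.
have -> : search true ts ts <-> verdict true (scanned l.2 ts) \/ search false ts ts.
  exact: search_true.
split.
- case=> [/vtrue[h|h|h]|/search_false[v _ /vfalse h]].
  + by apply: Or31; exists l.2.
  + exact: Or32.
  + exact: Or33.
  + by apply: Or31; exists v.
- case=> [[v vW]|h|h].
  + right; apply/search_false; exists v; last exact/vfalse.
    exact: (var_in_instance _ _ _ vW.1).
  + by left; apply/vtrue; apply: Or32.
  + by left; apply/vtrue; apply: Or33.
Qed.

(** * Preferred extensions *)

Local Open Scope classical_set_scope.

Lemma oppositeK : involutive opposite.
Proof. by case=> [[]]. Qed.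

Lemma lit_formula_inj : injective lit_formula.
Proof. by move=> [[] n] [[] k] //= [->]. Qed.

Lemma lit_default_inj : injective lit_default.
Proof. by move=> l l' /(congr1 conclusion)/lit_formula_inj. Qed.

(** * Entailment from sets of literals *)

Lemma entails_mem (S : set formula) f : S f -> entails S f.
Proof. by move=> Sf v; apply. Qed.

Lemma entails_sub (S S' : set formula) f : S `<=` S' -> entails S f -> entails S' f.
Proof. by move=> sub e v h; apply: e => g /sub/h. Qed.

Lemma entails_Cn (S : set formula) f : entails (Cn S) f <-> entails S f.
Proof.
split=> [e v h|]; last by apply: entails_sub => g; apply: entails_mem.
by apply: e => g; apply.
Qed.

Lemma entails_Neg S l :
  entails S (Neg (lit_formula l)) <-> entails S (lit_formula (opposite l)).
Proof.
by case: l => [[]] n; split=> e v /e //=; rewrite ?negbK.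
Qed.

Definition consistent (S : set formula) :=
  (forall f, S f -> exists l, f = lit_formula l) /\
  (forall l, S (lit_formula l) -> ~ S (lit_formula (opposite l))).

Lemma consistent_sub S S' : S `<=` S' -> consistent S' -> consistent S.
Proof. by move=> sub [lits cons]; split=> [f /sub/lits|l /sub/cons h /sub]. Qed.

(** If [l] is missing from [S], the valuation that falsifies [l] and follows [S] on all other
    variables is a model of [S]. *)
Lemma entails_lit S l : consistent S -> entails S (lit_formula l) -> S (lit_formula l).
Proof.
move=> [lits cons] e; apply: contrapT => nSl.
pose v q := if q == l.2 then ~~ l.1 else `[< S (Var q) >].
have /e : forall g, S g -> eval v g.
  move=> g Sg; have [[b q] gE] := lits _ Sg; subst g.
  have [ql|ql] := eqVneq q l.2.
    have bl : b = ~~ l.1.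
      apply: contra_notP nSl => /eqP bl; suff -> : l = (b, q) by [].
      by move: ql bl; case: (l) (b) => [[] n] [] //= ->.
    by rewrite bl ql; rewrite /v /lit_formula /=; case: (l.1); rewrite /= eqxx.
  case: b Sg => Sg; rewrite /= /v (negbTE ql); first exact/asboolP.
  by apply/asboolP; apply: (cons (false, q)).
by rewrite /v; case: (l) => [[] n]; rewrite /= eqxx.
Qed.

Lemma active_lit S l : consistent S ->
  active S (lit_default l) <->
  ~ S (lit_formula l) /\ ~ S (lit_formula (opposite l)).
Proof.
move=> cS; split=> [[_ nl no]|[nl no]].
  split=> h; first exact/no/entails_mem.
  by apply/nl/entails_Neg/entails_mem.
split; first by move=> v _.
  by move/entails_Neg/(entails_lit cS).
by move/(entails_lit cS).
Qed.

(** * Minimal elements and extensions to total orders *)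

Lemma exists_minimal (T : eqType) (R : T -> T -> Prop) (A : T -> Prop) (s : seq T) x :
  (forall a b c, R a b -> R b c -> R a c) -> (forall a b, R a b -> ~ R b a) ->
  x \in s -> A x ->
  exists m, [/\ m \in s, A m & forall y, y \in s -> A y -> ~ R y m].
Proof.
move=> Rtr Ras; elim: s x => // a s IH x xs Ax.
have [[y [ys Ay]]|none] := pselect (exists y, y \in s /\ A y).
  have [m [ms Am min]] := IH y ys Ay.
  (* Either the head [a] lies below the minimal element [m] of the tail, and is then minimal by
     transitivity, or [m] remains minimal. *)
  have [[Aa Ram]|na] := pselect (A a /\ R a m).
    exists a; split; rewrite ?mem_head // => z; rewrite in_cons => /orP[/eqP->|zs] Az.
      by move=> h; apply: (Ras _ _ h).
    by move=> Rza; apply: (min z zs Az); apply: Rtr Ram.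
  exists m; split=> //; first by rewrite in_cons ms orbT.
  move=> z; rewrite in_cons => /orP[/eqP-> Aa Ram|]; last exact: min.
  exact: na.
have xa : x = a.
  by move: xs; rewrite in_cons => /orP[/eqP//|xs]; case: none; exists x.
exists a; split; rewrite ?mem_head -?xa // => z; rewrite in_cons => /orP[/eqP->|zs] Az.
  by move=> h; exact: (Ras _ _ h h).
by case: none; exists z.
Qed.

Lemma linear_extension (T : eqType) (R : T -> T -> Prop) (s : seq T) :
  (forall a b c, R a b -> R b c -> R a c) -> (forall a b, R a b -> ~ R b a) ->
  exists t : seq T, t =i s /\
    forall a b, a \in s -> b \in s -> R a b -> index a t < index b t.
Proof.
move=> Rtr Ras; have [n] := ubnP (size s); elim: n s => // n IH [|x s] lt_s.
  by exists [::].
have [m [ms _ min]] := @exists_minimal _ R (fun=> True) (x :: s) x Rtr Ras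
  (mem_head _ _) I.
(* All copies of the minimal element [m] are removed; it is put in front of an ordering of the
   rest. *)
pose s' := [seq y <- x :: s | y != m].
have lt_s' : size s' < n.
  rewrite ltnS in lt_s; apply: leq_trans lt_s.
  rewrite size_filter ltn_neqAle count_size andbT -all_count.
  by apply/negP => /allP /(_ m ms); rewrite eqxx.
have [t [ts tR]] := IH s' lt_s'; exists (m :: t); split=> [y|a b al bl Rab].
  rewrite in_cons ts mem_filter; case: eqP => [->|] //=.
have bm : b != m by apply/eqP => bm; apply: (min a al I); rewrite -bm.
rewrite /= [m == b]eq_sym (negbTE bm); case: eqP => // /eqP am.
by rewrite ltnS; apply: tR => //; rewrite mem_filter ?bm ?al ?bl // eq_sym am.
Qed.

Lemma total_extension (s : seq default) (P : priority) :
  strict_partial_order [set` s] P ->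
  exists T, strict_total_order [set` s] T /\ forall d d', P d d' -> T d d'.
Proof.
move=> [PD Ptr Pas]; have [t [ts tR]] := linear_extension s Ptr Pas.
exists (fun d d' => [/\ d \in s, d' \in s & index d t < index d' t]); split; last first.
  by move=> d d' Pdd'; have [dS d'S] := PD _ _ Pdd'; split=> //; apply: tR.
split; [split|].
- by move=> d d' [].
- by move=> d e f [dS eS de] [_ fS ef]; split=> //; apply: ltn_trans ef.
- by move=> d d' [_ _ h] [_ _]; rewrite ltnNge (ltnW h).
- move=> d d' /= dS d'S ne.
  have : index d t != index d' t.
    apply/eqP => e; apply: ne.
    by rewrite -(nth_index d (_ : d \in t)) ?ts // e nth_index ?ts.
  by rewrite neq_ltn => /orP[]; [left|right].
Qed.

(** [Q] is the transitive closure of [P] with the pair [a], [b] added; it stays asymmetric because a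
    cycle through the new pair would yield [P b a] or [a = b]. *)
Lemma total_extension_with (s : seq default) (P : priority) (a b : default) :
  strict_partial_order [set` s] P -> a \in s -> b \in s -> a <> b -> ~ P b a ->
  exists T, [/\ strict_total_order [set` s] T, forall d d', P d d' -> T d d' & T a b].
Proof.
move=> [PD Ptr Pas] aS bS ab nPba.
pose Q d d' := P d d' \/ (d = a \/ P d a) /\ (d' = b \/ P b d').
have Qtr x y z : Q x y -> Q y z -> Q x z.
  move=> [xy|[xa yb]] [yz|[ya zb]].
  - by left; apply: Ptr yz.
  - right; split=> //; right; case: ya => [<-//|]; exact: Ptr.
  - right; split=> //; right; case: yb => [<-//|]h; exact: Ptr yz.
  - by right.
have Qas x y : Q x y -> ~ Q y x.
  (* No [u] lies both weakly before [a] and weakly after [b]; every use of the new pair in a cycle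
     would give such a [u]. *)
  have nbb u : (u = a \/ P u a) -> (u = b \/ P b u) -> False.
    move=> [->|ua] [|]; [exact: ab|exact: nPba|by move=> ub; apply: nPba; rewrite -ub|].
    by move=> bu; apply: nPba; apply: Ptr ua.
  move=> [xy|[xa yb]] [yx|[ya xb]].
  - exact: (Pas x y).
  - apply: (nbb y ya); case: xb => [<-|bx]; right => //; exact: Ptr xy.
  - apply: (nbb x xa); case: yb => [<-|bx]; right => //; exact: Ptr yx.
  - exact: (nbb x).
have [|T [oT QT]] := @total_extension s Q.
  split=> // d d' [/PD//|[da d'b]]; split.
    by case: da => [->|/PD[]].
  by case: d'b => [->|/PD[]].
exists T; split=> // [d d' Pdd'|]; apply: QT; first by left.
by right; split; left.
Qed.

(** * Increasing sequences of stages and their unions *)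

Lemma stage_mono (st : nat -> set formula) : (forall i, st i `<=` st i.+1) ->
  forall i j, i <= j -> st i `<=` st j.
Proof.
move=> h i j /subnKC <-; elim: (j - i) => [|k IH]; first by rewrite addn0.
by rewrite addnS => f /IH /h.
Qed.

Lemma stage_limit (st : nat -> set formula) (s : seq formula) :
  (forall i, st i `<=` st i.+1) ->
  exists i, forall f, f \in s -> (\bigcup_k st k) f -> st i f.
Proof.
move=> h; elim: s => [|g s [i hi]]; first by exists 0.
have [[k _ kg]|ng] := pselect ((\bigcup_k st k) g).
  exists (maxn i k) => f; rewrite in_cons => /orP[/eqP->_|fs /(hi _ fs)].
    exact: (stage_mono h (leq_maxr i k)).
  exact: (stage_mono h (leq_maxl i k)).
by exists i => f; rewrite in_cons => /orP[/eqP->//|]; apply: hi.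
Qed.

(** The union is finite, so a single stage already contains all of it. *)
Lemma bigcup_Cn (st : nat -> set formula) (s : seq formula) :
  (forall i, st i `<=` st i.+1) -> (\bigcup_k st k) `<=` [set` s] ->
  \bigcup_i Cn (st i) = Cn (\bigcup_i st i).
Proof.
move=> mono fin; have [i hi] := stage_limit s mono.
apply/seteqP; split=> f; first by case=> k _; apply: entails_sub => g; exists k.
by move=> e; exists i => //; apply: entails_sub e => g Ug; apply: hi => //; apply: fin.
Qed.

(** * The criterion for both semantics *)

Section Theory.
Variables (dl wl : seq literal) (P : priority).
Let D : set default := [set` map lit_default dl].
Let W : set formula := [set` map lit_formula wl].
Hypothesis orderP : strict_partial_order D P.
Implicit Types (R T : priority) (st : nat -> set formula) (l m : literal).

Definition unblocked R (S : set formula) l :=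
  ~ exists d, [/\ D d, R d (lit_default l) & active S d].

(* Shared by the stages of both semantics when [W] is consistent; it suffices for
   [grow_add] that the opposite literal is never derived at all. *)
Record growing R st : Prop := Growing {
  grow0 : st 0 = W;
  grow_mono : forall i, st i `<=` st i.+1;
  grow_new : forall i f, st i.+1 f -> ~ st i f ->
    exists l, [/\ f = lit_formula l, l \in dl & unblocked R (st i) l];
  grow_add : forall i l, l \in dl ->
    ~ (\bigcup_k st k) (lit_formula (opposite l)) -> unblocked R (st i) l ->
    st i.+1 (lit_formula l);
  grow_consistent : consistent (\bigcup_k st k) }.

Lemma inD l : D (lit_default l) <-> l \in dl.
Proof. by rewrite /D /= mem_map //; apply: lit_default_inj. Qed.

Lemma inW l : W (lit_formula l) <-> l \in wl.
Proof. by rewrite /W /= mem_map //; apply: lit_formula_inj. Qed.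

Lemma default_lit d : D d -> exists2 l, l \in dl & d = lit_default l.
Proof. by move=> /mapP. Qed.

Lemma growing_literals R st : growing R st ->
  \bigcup_k st k `<=` [set` map lit_formula (wl ++ dl)].
Proof.
move=> g f [i _]; elim: i => [|i IH] fi /=.
  by rewrite map_cat mem_cat; move: fi; rewrite (grow0 g) /W /= => ->.
have [/IH//|ni] := pselect (st i f).
have [l [-> ldl _]] := grow_new g fi ni.
by rewrite mem_map ?mem_cat ?ldl ?orbT //; apply: lit_formula_inj.
Qed.

Lemma growing_sub R st i : st i `<=` \bigcup_k st k.
Proof. by move=> f; exists i. Qed.

Lemma stage_consistent R st i : growing R st -> consistent (st i).
Proof. by move=> g; apply: consistent_sub (grow_consistent g) => f; exists i. Qed.

(** An undecided literal has an active default in the limit. Among all defaults active there, one of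
    highest priority is unblocked at a late stage, so its conclusion is added after all. *)
Lemma growing_decides R st : strict_partial_order D R -> growing R st ->
  forall l, l \in dl ->
  (\bigcup_k st k) (lit_formula l) \/ (\bigcup_k st k) (lit_formula (opposite l)).
Proof.
move=> [_ Rtr Ras] g l ldl; apply: contrapT => /not_orP[nl no].
(* From this stage on, activity of a default is the same as in the limit. *)
have [i hi] := stage_limit (map lit_formula (dl ++ map opposite dl)) (grow_mono g).
pose A x := active (\bigcup_k st k) (lit_default x).
have Al : A l by apply/(active_lit l (grow_consistent g)).
pose R' x y := R (lit_default x) (lit_default y).
have [m [mdl /(active_lit m (grow_consistent g))[nm nmo] min]] :=
  @exists_minimal _ R' A dl l (fun x y z => Rtr _ _ _) (fun x y => Ras _ _) ldl Al.
apply: nm; exists i.+1 => //; apply: (grow_add g) => // -[d [/default_lit[x xdl ->] Rxm]].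
move/(active_lit x (stage_consistent i g)) => [nx nxo].
apply: (min x xdl) Rxm; apply/(active_lit x (grow_consistent g)).
split=> [h|h]; [apply: nx|apply: nxo]; apply: hi => //; apply: map_f;
  rewrite mem_cat ?xdl // map_f ?orbT //.
Qed.

(** Otherwise the opposite literal is derived; just before it first appears, the default of [l] is
    active and, having priority, blocks it. *)
Lemma growing_dominant R st l : strict_partial_order D R -> growing R st ->
  l \in dl -> opposite l \notin wl ->
  opposite l \notin dl \/ R (lit_default l) (lit_default (opposite l)) ->
  (\bigcup_k st k) (lit_formula l).
Proof.
move=> oR g ldl ow h; have [//|[i _ ni]] := growing_decides oR g ldl; exfalso.
elim: i ni => [|i IH] ni; first by move: ni; rewrite (grow0 g) inW (negbTE ow).
have [/IH//|no] := pselect (st i (lit_formula (opposite l))).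
have [m [/lit_formula_inj <- odl]] := grow_new g ni no.
case: h => [/negP//|h]; apply; exists (lit_default l); split=> //; first exact/inD.
apply/(active_lit l (stage_consistent i g)); split=> // li.
have [_ cons] := grow_consistent g.
by apply: (cons l); [exists i|exists i.+1].
Qed.

(** The point is consistency. Opposite literals cannot enter at different stages, by the
    justification test, nor at the same one: both defaults would be active, and totality of [T]
    makes one block the other. *)
Lemma stage_B_growing T : consistent W -> strict_total_order D T ->
  growing T (stage_B D W T).
Proof.
move=> cW [[_ _ Tas] Ttot]; set st := stage_B D W T.
have mono i : st i `<=` st i.+1 by move=> f /=; left.
have new i f : st i.+1 f -> ~ st i f -> exists l,
    [/\ f = lit_formula l, l \in dl, unblocked T (st i) l &
        ~ entails (st i) (Neg (lit_formula l))].
  case=> // -[a [/default_lit[l ldl [-> -> _]] _ ne ub]] _.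
  by exists l.
have add i l : l \in dl -> ~ entails (st i) (Neg (lit_formula l)) ->
    unblocked T (st i) l -> st i.+1 (lit_formula l).
  by move=> ldl ne ub; right; exists Top; split=> //; apply/inD.
have cst i : consistent (st i).
  elim: i => // i IH; split=> [f fi|l li oi].
    have [|nf] := pselect (st i f); first exact: IH.1.
    by have [l [-> _ _ _]] := new i f fi nf; exists l.
  have fresh m : st i.+1 (lit_formula m) -> ~ st i (lit_formula m) ->
      [/\ m \in dl, unblocked T (st i) m & ~ st i (lit_formula (opposite m))].
    move=> mi nm; have [x [/lit_formula_inj<- mdl ub ne]] := new i _ mi nm.
    by split=> // h; apply: ne; apply/entails_Neg/entails_mem.
  have nl : ~ st i (lit_formula l).
    move=> h; have no := IH.2 _ h; have [_ _] := fresh _ oi no.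
    by rewrite oppositeK.
  have [ldl ubl no] := fresh _ li nl; have [odl ubo _] := fresh _ oi no.
  have al : active (st i) (lit_default l) by apply/active_lit.
  have ao : active (st i) (lit_default (opposite l)).
    by apply/active_lit => //; rewrite oppositeK.
  have ne : lit_default l <> lit_default (opposite l).
    by move/lit_default_inj; case: (l) => [[]].
  case: (Ttot _ _ ((inD l).2 ldl) ((inD (opposite l)).2 odl) ne) => h.
    by apply: ubo; exists (lit_default l); split=> //; apply/inD.
  by apply: ubl; exists (lit_default (opposite l)); split=> //; apply/inD.
split=> //.
- by move=> i f fi nf; have [l [? ? ? _]] := new i f fi nf; exists l.
- move=> i l ldl no ub; apply: add => // /entails_Neg/(entails_lit (cst i)) h.
  by apply: no; exists i.
- split=> [f [i _ /(cst i).1]//|l [i _ li] [j _ oj]].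
  apply: ((cst (maxn i j)).2 l).
    exact: (stage_mono mono (leq_maxl i j)).
  exact: (stage_mono mono (leq_maxr i j)).
Qed.

(** The two inclusions say that [E] and the union of the stages have the same consequences. Hence a
    literal derived by a default has no opposite in the union, as the justification is tested
    against [E]; the facts are consistent by assumption. *)
Lemma stage_BH_growing R E : consistent W ->
  E `<=` Cn (\bigcup_i stage_BH D W R E i) ->
  \bigcup_i stage_BH D W R E i `<=` Cn E ->
  growing R (stage_BH D W R E).
Proof.
move=> cW EU UE; set st := stage_BH D W R E in EU UE *.
have mono i : st i `<=` st i.+1 by move=> f /=; left.
have new i f : st i.+1 f -> ~ st i f -> exists l,
    [/\ f = lit_formula l, l \in dl, unblocked R (st i) l &
        ~ entails E (Neg (lit_formula l))].
  case=> // -[a [b [/default_lit[l ldl [-> -> ->]] _ ne ub]]] _.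
  by exists l.
have origin f : (\bigcup_i st i) f -> W f \/ exists2 l, f = lit_formula l &
    ~ entails E (Neg (lit_formula l)).
  case=> i _; elim: i => [|i IH] fi; first by left.
  have [/IH//|nf] := pselect (st i f).
  by right; have [l [-> _ _ ne]] := new i f fi nf; exists l.
have cU : consistent (\bigcup_i st i).
  split=> [f /origin[/cW.1//|[l -> _]]|l lU oU]; first by exists l.
  case: (origin _ lU) => [lW|[m /lit_formula_inj<- ne]]; last first.
    by apply: ne; apply/entails_Neg; apply: UE.
  case: (origin _ oU) => [oW|[m /lit_formula_inj<- ne]]; first exact: (cW.2 l).
  by apply: ne; apply/entails_Neg; rewrite oppositeK; apply: UE.
split=> //.
- by move=> i f fi nf; have [l [? ? ? _]] := new i f fi nf; exists l.
- move=> i l ldl no ub; right; exists Top, (lit_formula l); split=> //.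
  + exact/inD.
  + move/entails_Neg => e; apply: no; apply: (entails_lit cU).
    by apply/entails_Cn; apply: entails_sub e.
Qed.

(** The criterion [sure], with an abstract priority on defaults instead of a list of pairs. *)
Definition forced l : Prop :=
  [\/ exists v, (true, v) \in wl /\ (false, v) \in wl,
      l \in wl |
      [/\ opposite l \notin wl, l \in dl &
          opposite l \notin dl \/ P (lit_default l) (lit_default (opposite l))]].

Lemma facts_consistent :
  ~ (exists v, (true, v) \in wl /\ (false, v) \in wl) -> consistent W.
Proof.
move=> h; split=> [f /mapP[l _ ->]|l /inW lw /inW ow]; first by exists l.
by case: h; exists l.2; case: l lw ow => [[]].
Qed.

(** [R] is [P] itself for the first semantics and a total order extending it for the second. *)
Lemma forced_in_extension R st E l :
  E = \bigcup_i Cn (st i) -> st 0 = W -> strict_partial_order D R ->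
  (consistent W -> growing R st) -> (forall d d', P d d' -> R d d') ->
  forced l -> E (lit_formula l).
Proof.
move=> -> st0 oR gr PR fl.
have [[v [tv fv]]|/facts_consistent cW] :=
    pselect (exists v, (true, v) \in wl /\ (false, v) \in wl).
  exists 0; rewrite // /Cn /= st0 => u Wu.
  have /= ut := Wu _ ((inW (true, v)).2 tv); have /= := Wu _ ((inW (false, v)).2 fv).
  by rewrite ut.
case: fl => [[v [tv fv]]|lw|[ow ld h]].
- by case: (cW.2 (true, v)); apply/inW.
- by exists 0; rewrite // /Cn /= st0; apply/entails_mem/inW.
- have h' : opposite l \notin dl \/ R (lit_default l) (lit_default (opposite l)).
    by case: h => [|/PR]; [left|right].
  have [i _ li] := growing_dominant oR (gr cW) ld ow h'.
  by exists i => //; apply: entails_mem.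
Qed.

Lemma unforced_order l : ~ forced l -> consistent W /\ exists T,
  [/\ strict_total_order D T, forall d d', P d d' -> T d d' &
      ~ (\bigcup_i stage_B D W T i) (lit_formula l)].
Proof.
move=> nf; have cW : consistent W by apply: facts_consistent => h; apply: nf; apply: Or31.
have lw : l \notin wl by apply/negP => h; apply: nf; apply: Or32.
split=> //.
(* If both defaults exist and that of [l] lacks priority, the order is chosen to put the opposite
   first. Otherwise any total extension avoids [l]: deriving it would take a default and make [l]
   forced. *)
have [oldl|nodl] := pselect [/\ l \in dl, opposite l \in dl &
    ~ P (lit_default l) (lit_default (opposite l))]; last first.
  have [T [oT PT]] := total_extension orderP; exists T; split=> // lU.
  have g := stage_B_growing cW oT; have [_ cons] := grow_consistent g.
  have := growing_literals g lU; rewrite /= mem_map; last exact: lit_formula_inj.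
  rewrite mem_cat (negbTE lw) /= => ldl; apply: nf; apply: Or33; split=> //.
    apply/negP => ow; apply: (cons l) => //; exists 0 => //; exact/inW.
  have [ol|/negP ol] := boolP (opposite l \in dl); last by left.
  by right; apply: contrapT => nP; apply: nodl.
have [ldl odl nP] := oldl.
have ne : lit_default (opposite l) <> lit_default l.
  by move/lit_default_inj; case: (l) => [[]].
have [T [oT PT Tol]] := total_extension_with orderP ((inD _).2 odl) ((inD _).2 ldl) ne nP.
exists T; split=> // lU; have g := stage_B_growing cW oT.
have [_ cons] := grow_consistent g; apply: (cons l) => //.
apply: (growing_dominant oT.1 g odl); first by rewrite oppositeK.
by right; rewrite oppositeK.
Qed.

Lemma stage_B_union T : consistent W -> strict_total_order D T ->
  \bigcup_i Cn (stage_B D W T i) = Cn (\bigcup_i stage_B D W T i).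
Proof.
move=> cW oT; have g := stage_B_growing cW oT.
exact: bigcup_Cn (grow_mono g) (growing_literals g).
Qed.

(** The two constructions reach the same union [U]. Defaults applied under the first semantics are
    compatible with [U], which decides them all; conversely, a default unblocked for [T] becomes
    unblocked for the weaker [P] once the other stages have caught up. *)
Lemma preferred_B_BH T : consistent W -> strict_total_order D T ->
  (forall d d', P d d' -> T d d') ->
  preferred_BH D W P (\bigcup_i Cn (stage_B D W T i)).
Proof.
move=> cW oT PT; rewrite stage_B_union //.
have g := stage_B_growing cW oT; set U := \bigcup_i _ in g *.
have cU : consistent U := grow_consistent g.
pose st := stage_BH D W P (Cn U).
have st_mono i : st i `<=` st i.+1 by move=> f /=; left.
have stU : \bigcup_i st i `<=` U.
  move=> f [i _]; elim: i f => [|i IH] f; first by exists 0.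
  case=> [/IH//|[a [b [/default_lit[m mdl [-> -> ->]] _ ne _]]]].
  have [//|oU] := growing_decides oT.1 g mdl.
  by case: ne; apply/entails_Cn/entails_Neg/entails_mem.
have cst i : consistent (st i).
  by apply: consistent_sub cU => f fi; apply: stU; exists i.
have Ust : U `<=` \bigcup_i st i.
  move=> f [i _]; elim: i f => [|i IH] f; first by exists 0.
  have [/IH//|nf] := pselect (stage_B D W T i f).
  move=> fi; have [m [fE mdl ub]] := grow_new g fi nf; subst f.
  (* By induction stage [j] contains every literal of stage [i] that affects activity, so a default
     active at [j] was already active at [i]. *)
  have [j hj] := stage_limit (map lit_formula (dl ++ map opposite dl)) st_mono.
  exists j.+1 => //; right; exists Top, (lit_formula m); split=> //; first exact/inD.
    move/entails_Cn/entails_Neg/(entails_lit cU); apply: cU.2.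
    by exists i.+1.
  move=> [d [/default_lit[x xdl ->] Pxm /(active_lit x (cst j))[nx nxo]]].
  apply: ub; exists (lit_default x); split; [exact/inD|exact: PT|].
  apply/(active_lit x (stage_consistent i g)); split=> [/IH h|/IH h].
    by apply: nx; apply: hj => //; rewrite map_f // mem_cat xdl.
  by apply: nxo; apply: hj => //; rewrite map_f // mem_cat map_f ?orbT.
rewrite /preferred_BH -/st.
have -> : U = \bigcup_i st i by apply/seteqP.
rewrite (bigcup_Cn (s := map lit_formula (wl ++ dl)) st_mono) //.
by move=> f /stU; apply: growing_literals g _.
Qed.

Lemma entails_B_forced l : entails_B D W P (lit_formula l) <-> forced l.
Proof.
split=> [e|fl E [T [oT PT EE]]]; last first.
  exact: (forced_in_extension EE erefl oT.1 (fun cW => stage_B_growing cW oT)).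
apply: contrapT => /unforced_order[cW [T [oT PT nl]]].
have := e _ (ex_intro _ T (And3 oT PT erefl)); rewrite stage_B_union //.
by move/(entails_lit (grow_consistent (stage_B_growing cW oT))).
Qed.

Lemma entails_BH_forced l : entails_BH D W P (lit_formula l) <-> forced l.
Proof.
split=> [e|fl E EE].
  apply: contrapT => /unforced_order[cW [T [oT PT nl]]].
  have := e _ (preferred_B_BH cW oT PT); rewrite stage_B_union //.
  by move/(entails_lit (grow_consistent (stage_B_growing cW oT))).
apply: (forced_in_extension (R := P) EE erefl orderP _ _ fl) => // cW.
apply: stage_BH_growing => //.
  rewrite {1}EE => f [i _]; apply: entails_sub => h; exact: (@growing_sub).
by move=> f [i _ fi]; apply: entails_mem; rewrite EE; exists i => //; apply: entails_mem.
Qed.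

End Theory.

(** * From valid instances to the polynomial bound *)

Lemma map_preimage (A : Type) (B : eqType) (f : A -> B) (s : seq B) :
  (forall b, b \in s -> exists a, b = f a) -> exists t, s = map f t.
Proof.
elim: s => [|b s IH] h; first by exists [::].
have [a ->] := h b (mem_head _ _).
have [c cs|t ->] := IH; first by apply: h; rewrite in_cons cs orbT.
by exists (a :: t).
Qed.

Lemma literal_instanceE x : literal_instance x ->
  exists l D W P, x = lit_instance l D W P.
Proof.
case: x => q D W P [/= [v qE] unary lits [PD _ _]].
have {unary} [dl Dl] : exists s, D = map lit_default s.
  apply: map_preimage => d /unary[u [->|->]]; first by exists (true, u).
  by exists (false, u).
have {lits} [wl ->] : exists s, W = map lit_formula s.
  apply: map_preimage => f /lits[u [->|->]]; first by exists (true, u).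
  by exists (false, u).
have [pl ->] : exists s, P = [seq (lit_default p.1, lit_default p.2) | p <- s].
  apply: map_preimage => -[d d'] /PD[]; rewrite /theory_defaults /= Dl.
  by move=> /mapP[l _ ->] /mapP[l' _ ->]; exists (l, l').
rewrite Dl; case: qE => ->; first by exists (true, v), dl, wl, pl.
by exists (false, v), dl, wl, pl.
Qed.

Lemma sure_forced l D W P :
  sure l D W P <-> forced D W (priority_of (lit_instance l D W P)) l.
Proof.
have pE a b : priority_of (lit_instance l D W P) (lit_default a) (lit_default b) <->
    (a, b) \in P.
  rewrite /priority_of /= -[(a, b) \in P](mem_map
    (f := fun p => (lit_default p.1, lit_default p.2))) //.
  move=> [c d] [c' d'] e; congr pair; apply: lit_default_inj.
    exact: (congr1 fst e).
  exact: (congr1 snd e).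
rewrite /sure /forced; split=> [] [h|h|[h1 h2 h3]]; try (by apply: Or31); try (by apply: Or32).
  by apply: Or33; split=> //; rewrite pE.
by apply: Or33; split=> //; rewrite -pE.
Qed.

Lemma poly_time_forced (yes : instance -> Prop) :
  (forall l D W P, literal_instance (lit_instance l D W P) ->
    yes (lit_instance l D W P) <-> sure l D W P) ->
  poly_time_testable code_instance literal_instance yes.
Proof.
move=> yesE; exists decider, (4%N%:P * ('X + 1) ^+ 2)%R => x xv.
have [l [D [W [P xE]]]] := literal_instanceE xv.
have [n [le ans]] := decider_answers (plain_instance_tokens l D W P).
exists n, (search true (instance_tokens l D W P) (instance_tokens l D W P)).
rewrite xE -code_instance_tokens; split=> //.
  move: le; rewrite hornerM hornerC horner_exp hornerD hornerX hornerC.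
  by rewrite natrXE natrDE natrME [size _ + _]addn1.
by rewrite search_instance yesE // -xE.
Qed.

Theorem theorem4p11 :
  poly_time_testable code_instance literal_instance
    (fun x => entails_BH (theory_defaults x) (theory_facts x) (priority_of x)
                (query x)) /\
  poly_time_testable code_instance literal_instance
    (fun x => entails_B (theory_defaults x) (theory_facts x) (priority_of x)
                (query x)).
Proof.
split; apply: poly_time_forced => l D W P [_ _ _ oP]; rewrite sure_forced.
  exact: entails_BH_forced oP l.
exact: entails_B_forced oP l.
Qed.
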